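(* Let $k\ge1$. Then $$|\pi_1(\mathrm{Diff}^{(1)}_{\alpha,\mathrm{str},A}(\mathbb R^{2k}\setminus\{0\}))|=\infty .$$
   Context: On $\mathbb R^{2k}=\mathbb C^k$ with coordinates $z^i=(x^i,\xi^i)$, $i=1,\dots,k$, let $\alpha=\frac12\sum_{i=1}^k(x^id\xi^i-\xi^idx^i)$. A diffeomorphism $\phi$ of $\mathbb R^{2k}\setminus\{0\}$ is of homogeneous degree one if $\phi(rx,r\xi)=r\,\phi(x,\xi)$ for all $r>0$; the group of these is $\mathrm{Diff}^{(1)}(\mathbb R^{2k}\setminus\{0\})$, and $\mathrm{Diff}^{(1)}_{\alpha,\mathrm{str}}(\mathbb R^{2k}\setminus\{0\})=\{\phi\in\mathrm{Diff}^{(1)}(\mathbb R^{2k}\setminus\{0\}):\phi^*\alpha=\alpha\}$. The map $A:\mathrm{Diff}(S^{2k-1})\to\mathrm{Diff}^{(1)}(\mathbb R^{2k}\setminus\{0\})$, where $S^{2k-1}$ is the unit sphere, is the homogeneous extension $(A\hat\phi)(r\hat x,r\hat\xi)=r\,\hat\phi(\hat x,\hat\xi)$ for $(\hat x,\hat\xi)\in S^{2k-1}$, $r>0$. Set $$\mathrm{Diff}^{(1)}_{\alpha,\mathrm{str},A}(\mathbb R^{2k}\setminus\{0\})=\{\phi\in\mathrm{Diff}^{(1)}_{\alpha,\mathrm{str}}(\mathbb R^{2k}\setminus\{0\}):\phi\in\mathrm{Im}(A)\},$$ with the $C^\infty$ topology (equivalently, that of the restrictions to $S^{2k-1}$ in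 $\mathrm{Diff}(S^{2k-1})$); $\pi_1$ is based at the identity. *)

(* Defs.v *)
From HB Require Import structures.
From mathcomp Require Import all_boot all_order all_algebra.
From mathcomp Require Import all_classical all_reals all_analysis.
From mathcomp Require Import homotopy.

Set Implicit Arguments.
Unset Strict Implicit.
Unset Printing Implicit Defensive.

Import Order.TTheory GRing.Theory Num.Theory.
Import numFieldNormedType.Exports.

Local Open Scope classical_set_scope.
Local Open Scope ring_scope.

Section SmoothMaps.
Context {R : realType} {n m : nat}.
Implicit Types (f g : 'rV[R]_n -> 'rV[R]_m) (A U : set 'rV[R]_n).

(* partials [:: i1; ...; ir] f = d_i1 (... (d_ir f)) *)
Definition partials (s : seq 'I_n) f : 'rV[R]_n -> 'rV[R]_m :=
  foldr (fun i g => 'D_(delta_mx 0 i) g) f s.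

(* Only meaningful for U open. *)
Definition smooth_on_open U f : Prop :=
  forall (s : seq 'I_n) x, U x -> differentiable (partials s f) x.

(* Smoothness on an arbitrary subset of R^n: local smooth extendability. For A
   open this is smooth_on_open A f, for A the unit sphere it is smoothness on
   the submanifold A. Only the values of f on A matter. *)
Definition smooth_on A f : Prop :=
  forall x, A x -> exists U g,
    [/\ open U, U x, smooth_on_open U g & {in A `&` U, f =1 g}].

Definition compact_subsets U : set_system 'rV[R]_n :=
  [set K | compact K /\ K `<=` U].

Definition all_partials U f :
    {ptws seq 'I_n -> {family compact_subsets U, 'rV[R]_n -> 'rV[R]_m}} :=
  fun s => partials s f.

(* The C^oo topology on maps defined on the open set U: uniform convergence of
   every iterated partial derivative on every compact subset of U. *)
Definition Coo_space U : topologicalType := initial_topology (all_partials U).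

End SmoothMaps.

(* A diffeomorphism of A is encoded as a total map, normalised to be the
   identity outside A so that it is determined by its values on A. *)
Definition diffeo {R : realType} {n : nat} (A : set 'rV[R]_n)
    (f : 'rV[R]_n -> 'rV[R]_n) : Prop :=
  [/\ set_bij A A f, {in ~` A, f =1 id}, smooth_on A f &
      exists2 g, smooth_on A g & {in A, cancel f g}].

Section Diff1.
Context {R : realType} {k : nat}.
(* The first k coordinates are x^1, ..., x^k, the last k are xi^1, ..., xi^k. *)
Local Notation V := 'rV[R]_(k + k).
Implicit Types (f phi : V -> V) (p v : V).

Definition one_form := V -> V -> R.

Definition alpha : one_form := fun p v =>
  2^-1 * \sum_(i < k) (p 0 (lshift k i) * v 0 (rshift k i)
                       - p 0 (rshift k i) * v 0 (lshift k i)).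

Definition pullback phi (w : one_form) : one_form :=
  fun p v => w (phi p) ('d phi p v).

Definition punctured : set V := [set p | p != 0].

(* The library norm on row vectors is the sup norm. *)
Definition enorm p : R := Num.sqrt (\sum_(i < k + k) p 0 i ^+ 2).

Definition sphere : set V := [set p | enorm p = 1].

Definition homogeneous1 phi : Prop :=
  forall (r : R) p, 0 < r -> p != 0 -> phi (r *: p) = r *: phi p.

Definition Diff1 : set (V -> V) :=
  [set phi | diffeo punctured phi /\ homogeneous1 phi].

Definition Diff1_alpha_str : set (V -> V) :=
  [set phi | Diff1 phi /\
     {in punctured, forall p v, pullback phi alpha p v = alpha p v}].

(* The map A; its value at the origin is 0, in accordance with the
   normalisation in diffeo. *)
Definition homogeneous_extension f : V -> V :=
  fun p => enorm p *: f ((enorm p)^-1 *: p).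

Definition Diff1_alpha_str_A : set (Coo_space (m := k + k) punctured) :=
  [set phi | Diff1_alpha_str phi /\
             (homogeneous_extension @` diffeo sphere) phi].

End Diff1.
Arguments Diff1_alpha_str_A R k : clear implicits.

Definition unit_interval (R : realType) : Type :=
  set_type (`[0, 1]%classic : set R).

Section UnitInterval.
Context {R : realType}.

HB.instance Definition _ := Topological.on (unit_interval R).

Let ui0_subproof : (0 : R) \in `[0, 1]%classic.
Proof. by rewrite inE /= in_itv /= lexx ler01. Qed.

Let ui1_subproof : (1 : R) \in `[0, 1]%classic.
Proof. by rewrite inE /= in_itv /= lexx ler01. Qed.

Definition ui0 : unit_interval R := exist _ 0 ui0_subproof.
Definition ui1 : unit_interval R := exist _ 1 ui1_subproof.

Let ui0_neq1 : ui0 != ui1.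
Proof. by apply/eqP => /(congr1 val)/eqP; rewrite /= eq_sym oner_eq0. Qed.

HB.instance Definition _ := isBiPointed.Build (unit_interval R) ui0_neq1.

End UnitInterval.

Section FundamentalGroup.
Context {R : realType} {X : topologicalType}.
Local Notation I := (unit_interval R).

(* Homotopy relative to the endpoints. *)
Definition path_homotopic (x y : X) (a b : {path I from x to y}) : Prop :=
  exists H : I * I -> X,
    [/\ continuous H,
        forall t, H (zero, t) = a t,
        forall t, H (one, t) = b t &
        forall s, H (s, zero) = x /\ H (s, one) = y].

(* The underlying set of pi_1(X, x): homotopy classes of loops at x. *)
Definition pi1 (x : X) : set (set {path I from x to x}) :=
  range (@path_homotopic x x).

End FundamentalGroup.
Arguments pi1 R {X} x.

Section Identity.
Context {R : realType}.

Lemma partials_id (n : nat) (s : seq 'I_n) :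
  partials s (id : 'rV[R]_n -> 'rV[R]_n) =
  match s with [::] => id | [:: i] => cst (delta_mx 0 i) | _ => cst 0 end.
Proof.
elim: s => [//|i s IH]; rewrite -[LHS]/('D_(delta_mx 0 i) (partials s id)) IH.
case: s {IH} => [|j [|l s]]; apply/funext => x.
- by rewrite derive_id.
- by rewrite derive_cst.
- by rewrite derive_cst.
Qed.

Lemma smooth_on_id (n : nat) (A : set 'rV[R]_n) : smooth_on A id.
Proof.
move=> x Ax; exists setT, id; split => //; first exact: openT.
by move=> s y _; rewrite partials_id; case: s => [|i [|]].
Qed.

Lemma diffeo_id (n : nat) (A : set 'rV[R]_n) : diffeo A id.
Proof.
split=> //; [split=> // x Ax; by exists x | exact: smooth_on_id |].
by exists id; [exact: smooth_on_id | move=> ?].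
Qed.

Lemma enorm_eq0 (k : nat) (p : 'rV[R]_(k + k)) : enorm p = 0 -> p = 0.
Proof.
move=> /eqP; rewrite sqrtr_eq0 => p0.
have /eqP : \sum_(i < k + k) p 0 i ^+ 2 = 0.
  by apply/le_anti; rewrite p0 sumr_ge0// => i _; rewrite sqr_ge0.
rewrite psumr_eq0 => [/allP pi0|i _]; last by rewrite sqr_ge0.
apply/rowP => i; rewrite mxE.
by have := pi0 i (mem_index_enum _); rewrite /= sqrf_eq0 => /eqP.
Qed.

Lemma Diff1_alpha_str_A_id (k : nat) : Diff1_alpha_str_A R k id.
Proof.
split; last first.
  exists id; first exact: diffeo_id.
  apply/funext => p; rewrite /homogeneous_extension scalerA.
  have [/enorm_eq0 ->|p0] := eqVneq (enorm p) 0; first by rewrite scaler0.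
  by rewrite divff// scale1r.
split; first by split => //; exact: diffeo_id.
move=> p _ v; rewrite /pullback.
by have -> : 'd id p = id :> ('rV[R]_(k + k) -> _) by exact: diff_val.
Qed.

Definition Diff1_id (k : nat) : Diff1_alpha_str_A R k :=
  exist _ id (mem_set (Diff1_alpha_str_A_id k)).

End Identity.
Arguments Diff1_id R k : clear implicits.

(* Main.v *)
(** Rotating all coordinates of C^k simultaneously by e^{2 pi i n t}, t in
    [0, 1], gives a loop rho_n in the group, and these loops are pairwise non
    homotopic.  Differentiating phi^* alpha = alpha (with the symmetry of second
    derivatives) shows that the derivative of phi at a fixed point p is
    symplectic.  The complex-linear part of a symplectic map is invertible, so
    its complex determinant defines a continuous map from the group to C^*,
    which sends rho_n to the loop t |-> e^{2 pi i k n t} of winding number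
    k n. *)

Require Import Defs.
From mathcomp Require Import all_boot all_order all_algebra.
From mathcomp Require Import all_classical all_reals all_analysis.
From mathcomp Require Import homotopy complex ring lra.

Set Implicit Arguments.
Unset Strict Implicit.
Unset Printing Implicit Defensive.

Import Order.TTheory GRing.Theory Num.Theory.
Import numFieldNormedType.Exports.

Local Open Scope classical_set_scope.
Local Open Scope ring_scope.

(** * Winding numbers *)

(** The orbit of a point under a loop lies in R^{2k} minus the origin, which is simply connected for
    k >= 2, so positions cannot tell the loops apart; the derivative at a point can, and the C^oo
    topology makes it depend continuously on the map. The determinant of the complex-linear part
    stands in for the retraction of Sp(2k) onto U(k) followed by the determinant: it is polynomial
    in the entries, hence visibly continuous, and agrees with the usual determinant on U(k). The
    symplectic property keeps it away from 0 at every stage of a homotopy, not only on the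
    rotations. No integer winding number is built: loops in C^* are compared by the total increments
    of continuous angles along them, so a homotopy between rho_m and rho_n yields 2 pi m k = 2 pi n
    k. *)

Lemma locally_constant_prop (R : realType) (P : R -> Prop) :
  (forall x, \forall y \near x, P y <-> P x) -> forall x y, P x -> P y.
Proof.
move=> Ploc x y Px.
have oP (Q : R -> Prop) : (forall x, \forall y \near x, Q y <-> Q x) -> open Q.
  move=> Qloc; rewrite openE => u Qu; rewrite /interior.
  by apply: filterS (Qloc u) => v [_]; exact.
have cT : connected [set: R] by apply/connected_intervalP.
have -> : P y = setT y; last by [].
(* The truth set of [P] is non-empty and clopen in the connected line, hence everything. *)
congr (_ y); apply: cT; first by exists x.
  by exists P; [exact: oP|rewrite setTI].
exists P; last by rewrite setTI.
rewrite -openC; apply: oP => u; apply: filterS (Ploc u) => v.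
by rewrite /setC /=; tauto.
Qed.

Lemma continuous_pair (T U V : topologicalType) (f : T -> U) (g : T -> V) :
  continuous f -> continuous g -> continuous (fun x => (f x, g x)).
Proof. by move=> cf cg x; exact: (cvg_pair (cf x) (cg x)). Qed.

Section Polar.
Context {R : realType}.
Implicit Types (z w : R[i]) (a b : R).

(** A relation instead of an argument function: no branch is chosen, the angle is free up to
    multiples of 2 pi, and [z] is forced to be non-zero. *)
Definition polar z a : Prop :=
  exists2 r, 0 < r & z = Complex (r * cos a) (r * sin a).

Lemma polarM z w a b : polar z a -> polar w b -> polar (z * w) (a + b).
Proof.
move=> [r r0 ->] [s s0 ->]; exists (r * s); first exact: mulr_gt0.
by rewrite cosD sinD; congr Complex => /=; ring.
Qed.

Lemma polar1 : polar (1 : R[i]) 0.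
Proof. by exists 1; rewrite ?cos0 ?sin0 ?mulr1 ?mulr0. Qed.

Lemma polarX z a n : polar z a -> polar (z ^+ n) (a *+ n).
Proof.
move=> za; elim: n => [|n IH]; first exact: polar1.
by rewrite exprS mulrS; exact: polarM.
Qed.

Lemma polar_conj z a : polar z a -> polar (conjc z) (- a).
Proof. by move=> [r r0 ->]; exists r => //=; rewrite cosN sinN mulrN. Qed.

Lemma polar_scale z a r : 0 < r -> polar (Complex r 0 * z) a -> polar z a.
Proof.
move=> r0 [s s0 E]; exists (r^-1 * s); first by rewrite mulr_gt0 ?invr_gt0.
case: z E => x y; rewrite -[_ * _]/(Complex (r * x - 0 * y) (r * y + 0 * x)).
rewrite !mul0r subr0 addr0 => -[Ex Ey].
by rewrite -!mulrA -Ex -Ey !mulrA mulVf ?mul1r ?gt_eqF.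
Qed.

(** On the right half-plane [atan] of the slope is a branch of the argument; this is the only branch
    used below. *)
Lemma polar_atan z : 0 < complex.Re z -> polar z (atan (complex.Im z / complex.Re z)).
Proof.
case: z => x y /= x0; set t := y / x.
have ct0 : 0 < cos (atan t).
  by apply: cos_gt0_pihalf; rewrite atan_gtNpi2 atan_ltpi2.
exists (x / cos (atan t)); first exact: divr_gt0.
congr Complex; first by rewrite divfK ?gt_eqF.
rewrite -mulrA [_^-1 * _]mulrC -/(tan (atan t)) atanK /t mulrC divfK//.
by rewrite gt_eqF.
Qed.

Lemma polar_cosB z a b : polar z a -> polar z b -> cos (a - b) = 1.
Proof.
move=> [r r0 ->] [s s0 [Ec Es]].
have rs : r = s.
  have : r ^+ 2 = s ^+ 2.
    rewrite -[LHS]mulr1 -[RHS]mulr1 -{1}(cos2Dsin2 a) -(cos2Dsin2 b).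
    by rewrite !mulrDr -!exprMn Ec Es.
  by move=> /eqP; rewrite eqrXn2 ?ltW// => /eqP.
have rn0 : r != 0 by rewrite gt_eqF.
rewrite cosB -[RHS](cos2Dsin2 b) !expr2.
have -> : cos a = cos b by apply: (mulfI rn0); rewrite Ec rs.
by have -> : sin a = sin b by apply: (mulfI rn0); rewrite Es rs.
Qed.

End Polar.

(** The values of [D] on [0, 1] lie in the discrete set 2 pi Z, so [D] cannot move without crossing
    a forbidden value. *)
Lemma continuous_cos_eq1 (R : realType) (D : R -> R) : continuous D ->
  (forall t : R, t \in `[0, 1] -> cos (D t) = 1) -> D 0 = D 1.
Proof.
wlog lt01 : D / D 0 < D 1.
  move=> H cD D1; case: (ltgtP (D 0) (D 1)) => // [/H|lt]; first exact.
  apply: oppr_inj; apply: (H (fun t => - D t)); first by rewrite ltrN2.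
    by move=> t; apply: cvgN; exact: cD.
  by move=> t t01; rewrite cosN D1.
move=> cD D1.
have sin0 t : t \in `[0, 1] -> sin (D t) = 0.
  move=> /D1 c1; have := cos2Dsin2 (D t).
  by rewrite c1 expr1n -[RHS]addr0 => /addrI/eqP; rewrite sqrf_eq0 => /eqP.
(* Below [D 1], so that the intermediate value theorem reaches it; at most pi above [D 0], so that
   [v - D 0] lies where [cos] is injective. *)
pose v := Num.min (D 1) (D 0 + pi).
have D0v : D 0 < v by rewrite lt_min lt01 ltrDl pi_gt0.
have [c c01 Dc] : exists2 c, c \in `[0, 1] & D c = v.
  apply: IVT => //; first exact: continuous_subspaceT.
  by rewrite (min_idPl (ltW lt01)) (max_idPr (ltW lt01)) ltW//= ge_min lexx.
have I0 : (0 : R) \in `[0, 1] by rewrite in_itv /= lexx ler01.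
have : v - D 0 = 0.
  apply: cos_inj; rewrite ?in_itv /= ?lexx ?pi_ge0 //.
    by rewrite subr_ge0 ltW//= lerBlDl ge_min lexx orbT.
  by rewrite cosB -Dc !D1// !sin0// mulr0 addr0 mulr1 cos0.
by move=> /eqP; rewrite subr_eq0 gt_eqF.
Qed.

Section ComplexContinuous.
Context {R : realType} {T : topologicalType}.
Implicit Types f g : T -> R[i].

Definition ccontinuous f : Prop :=
  continuous (fun x => complex.Re (f x)) /\ continuous (fun x => complex.Im (f x)).

Lemma ccontinuous_cst z : ccontinuous (cst z).
Proof. by split=> x; exact: cvg_cst. Qed.

Lemma ccontinuousD f g : ccontinuous f -> ccontinuous g ->
  ccontinuous (fun x => f x + g x).
Proof.
move=> [f1 f2] [g1 g2]; split=> x.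
  rewrite (_ : (fun x => _) = (fun x => complex.Re (f x) + complex.Re (g x))).
    by apply: cvgD; [exact: f1|exact: g1].
  by apply/funext => y; case: (f y) (g y) => [? ?] [].
rewrite (_ : (fun x => _) = (fun x => complex.Im (f x) + complex.Im (g x))).
  by apply: cvgD; [exact: f2|exact: g2].
by apply/funext => y; case: (f y) (g y) => [? ?] [].
Qed.

Lemma ccontinuousM f g : ccontinuous f -> ccontinuous g ->
  ccontinuous (fun x => f x * g x).
Proof.
move=> [f1 f2] [g1 g2]; split=> x.
  rewrite (_ : (fun x => _) = (fun x => complex.Re (f x) * complex.Re (g x) -
      complex.Im (f x) * complex.Im (g x))).
    by apply: cvgB; apply: cvgM; [exact: f1|exact: g1|exact: f2|exact: g2].
  by apply/funext => y; case: (f y) (g y) => [? ?] [].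
rewrite (_ : (fun x => _) = (fun x => complex.Re (f x) * complex.Im (g x) +
    complex.Im (f x) * complex.Re (g x))).
  by apply: cvgD; apply: cvgM; [exact: f1|exact: g2|exact: f2|exact: g1].
by apply/funext => y; case: (f y) (g y) => [? ?] [].
Qed.

Lemma ccontinuous_conj f : ccontinuous f -> ccontinuous (fun x => conjc (f x)).
Proof.
move=> [f1 f2]; split=> x.
  rewrite (_ : (fun x => _) = (fun x => complex.Re (f x))); first exact: f1.
  by apply/funext => y; case: (f y).
rewrite (_ : (fun x => _) = (fun x => - complex.Im (f x))).
  by apply: cvgN; exact: f2.
by apply/funext => y; case: (f y).
Qed.

Lemma ccontinuous_sum (I : Type) (r : seq I) (f : I -> T -> R[i]) :
  (forall i, ccontinuous (f i)) -> ccontinuous (fun x => \sum_(i <- r) f i x).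
Proof.
move=> cf; elim: r => [|i r IH].
  by under eq_fun do rewrite big_nil; exact: ccontinuous_cst.
by under eq_fun do rewrite big_cons; exact: ccontinuousD.
Qed.

Lemma ccontinuous_prod (I : Type) (r : seq I) (f : I -> T -> R[i]) :
  (forall i, ccontinuous (f i)) -> ccontinuous (fun x => \prod_(i <- r) f i x).
Proof.
move=> cf; elim: r => [|i r IH].
  by under eq_fun do rewrite big_nil; exact: ccontinuous_cst.
by under eq_fun do rewrite big_cons; exact: ccontinuousM.
Qed.

Lemma ccontinuous_det n (M : T -> 'M[R[i]]_n) :
  (forall i j, ccontinuous (fun x => M x i j)) ->
  ccontinuous (fun x => \det (M x)).
Proof.
move=> cM; apply: ccontinuous_sum => s; apply: ccontinuousM.
  exact: ccontinuous_cst.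
by apply: ccontinuous_prod.
Qed.

End ComplexContinuous.

Lemma ccontinuous_comp (R : realType) (S T : topologicalType) (h : S -> T)
  (f : T -> R[i]) : continuous h -> ccontinuous f -> ccontinuous (f \o h).
Proof.
move=> ch [f1 f2]; split=> x.
  by apply: (@continuous_comp _ _ _ h (fun x => complex.Re (f x))); [exact: ch|exact: f1].
by apply: (@continuous_comp _ _ _ h (fun x => complex.Im (f x))); [exact: ch|exact: f2].
Qed.

Section Clamp.
Context {R : realType}.

(** The retraction of the line onto [0, 1]. It extends data on the interval to all of [R], where
    continuity and connectedness are handled without subspaces. *)
Definition clamp (t : R) : R := Num.max 0 (Num.min t 1).

Lemma clamp_itv t : clamp t \in `[0, 1].
Proof. by rewrite in_itv /= /clamp le_max lexx /= ge_max ler01 ge_min lexx orbT. Qed.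

Lemma clamp_id t : t \in `[0, 1] -> clamp t = t.
Proof.
rewrite in_itv /= /clamp => /andP[t0 t1].
by rewrite (min_idPl t1) (max_idPr t0).
Qed.

Lemma continuous_clamp : continuous clamp.
Proof.
move=> x; rewrite (_ : clamp = cst 0 \max (id \min cst 1)) //.
apply: continuous_max; first exact: cst_continuous.
by apply: continuous_min; [by move=> ?|exact: cst_continuous].
Qed.

End Clamp.

Section Winding.
Context {R : realType}.
Local Notation Re := (@complex.Re R).
Local Notation Im := (@complex.Im R).

(* The homotopy is lifted through exp one small step in s at a time: P s says
   that F(s, -) / F(0, -) has a continuous logarithm vanishing at both ends. *)
Lemma winding_homotopy_invariant (F : R * R -> R[i]) (a b : R -> R) :
  ccontinuous F -> (forall x, F x != 0) ->
  (forall s, F (s, 0) = F (0, 0) /\ F (s, 1) = F (0, 1)) ->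
  continuous a -> continuous b ->
  (forall t : R, t \in `[0, 1] -> polar (F (0, t)) (a t)) ->
  (forall t : R, t \in `[0, 1] -> polar (F (1, t)) (b t)) ->
  a 1 - a 0 = b 1 - b 0.
Proof.
move=> cF F0 Fe ca cb Fa Fb.
have I0 : (0 : R) \in `[0, 1] by rewrite in_itv /= lexx ler01.
have I1 : (1 : R) \in `[0, 1] by rewrite in_itv /= lexx ler01.
(* Quotients are replaced by products with the conjugate: the two differ by a positive real factor,
   which [polar] does not see. *)
have nF (z : R[i]) : z != 0 -> exists2 r, 0 < r & z * conjc z = Complex r 0.
  case: z => x y z0; exists (x ^+ 2 + y ^+ 2).
    have := addr_ge0 (sqr_ge0 x) (sqr_ge0 y).
    rewrite le_eqVlt => /predU1P[|//] /esym/eqP.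
    rewrite paddr_eq0 ?sqr_ge0// !sqrf_eq0 => xy0.
    by move: z0; rewrite eq_complex /= xy0.
  by congr Complex; rewrite /=; ring.
pose P s := exists L : R -> R, [/\ continuous L, L 0 = 0, L 1 = 0 &
  forall t : R, t \in `[0, 1] -> polar (F (s, t) * conjc (F (0, t))) (L t)].
have step u s : (forall t : R, t \in `[0, 1] ->
    0 < Re (F (u, t) * conjc (F (s, t)))) -> P s -> P u.
  move=> us [L [cL L0 L1 Ls]].
  (* Positivity of the real part is known for t in [0, 1] only; clamping makes it hold on the whole
     line, so that the [atan] of the slope is continuous everywhere. *)
  pose G t := F (u, clamp t) * conjc (F (s, clamp t)).
  have [G1 G2] : ccontinuous G.
    have cFv v : ccontinuous (fun t => F (v, clamp t)).
      apply: (@ccontinuous_comp _ _ _ (fun t => (v, clamp t)) F) => //.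
      by apply: continuous_pair; [exact: cst_continuous|exact: continuous_clamp].
    by apply: ccontinuousM; last apply: ccontinuous_conj; exact: cFv.
  have G0 t : 0 < Re (G t) by exact/us/clamp_itv.
  exists (fun t => atan (Im (G t) / Re (G t)) + L t); split.
  - move=> t; apply: cvgD; last exact: cL.
    apply: (@continuous_comp _ _ _ (fun t => Im (G t) / Re (G t)) atan).
      apply: cvgM; first exact: G2.
      by apply: cvgV; [rewrite gt_eqF|exact: G1].
    exact: continuous_atan.
  - rewrite L0 addr0 /G clamp_id// (Fe u).1 (Fe s).1.
    by have [r _ ->] := nF (F (0, 0)) (F0 _); rewrite mul0r atan0.
  - rewrite L1 addr0 /G clamp_id// (Fe u).2 (Fe s).2.
    by have [r _ ->] := nF (F (0, 1)) (F0 _); rewrite mul0r atan0.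
  - move=> t t01; have [r r0 Er] := nF (F (s, t)) (F0 _).
    apply: (polar_scale r0); rewrite -Er.
    (* Telescoping: the positive factor [F (s, t) * conjc (F (s, t))] splits the angle from 0 to u
       into the steps s to u and 0 to s. *)
    have -> : F (s, t) * conjc (F (s, t)) * (F (u, t) * conjc (F (0, t))) =
      F (u, t) * conjc (F (s, t)) * (F (s, t) * conjc (F (0, t))) by ring.
    apply: polarM; last exact: Ls.
    by have := polar_atan (G0 t); rewrite /G clamp_id.
have Ploc s : \forall u \near s, P u <-> P s.
  (* Positivity at u = s persists near each (t, s); compactness of [0, 1] gives one neighbourhood of
     s valid for all t. *)
  have : \forall u \near s, `[0, 1] `<=` (fun t =>
      0 < Re (F (u, t) * conjc (F (s, t)))).
    have /compact_near_coveringP cov := @segment_compact R 0 1.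
    apply: (cov R (nbhs s) (fun u t => 0 < Re (F (u, t) * conjc (F (s, t))))).
    move=> t _.
    pose K (x : R * R) := F (x.2, x.1) * conjc (F (s, x.1)).
    have [K1 _] : ccontinuous K.
      apply: ccontinuousM; last apply: ccontinuous_conj.
        apply: (@ccontinuous_comp _ _ _ (fun x : R * R => (x.2, x.1)) F) => //.
        by apply: continuous_pair => x; [exact: cvg_snd|exact: cvg_fst].
      apply: (@ccontinuous_comp _ _ _ (fun x : R * R => (s, x.1)) F) => //.
      by apply: continuous_pair => x; [exact: cvg_cst|exact: cvg_fst].
    have K0 : 0 < Re (K (t, s)) by rewrite /K; have [r ? ->] := nF _ (F0 (s, t)).
    have H := cvgr_gt (Re (K (t, s))) (K1 (t, s)) _ K0.
    exact: H.
  (* The real part of z times the conjugate of w is symmetric in z and w, so the step can be taken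
     in both directions. *)
  apply: filterS => u us; split; apply: step; last exact: us.
  move=> t /us; case: (F (u, t)) (F (s, t)) => [x y] [x' y'] /=.
  by rewrite !mulrN !opprK [x' * _]mulrC [y' * _]mulrC.
have [L [cL L0 L1 LP]] : P 1.
  apply: (locally_constant_prop Ploc (x := 0)); exists (cst 0); split => //.
    by move=> x; exact: cvg_cst.
  move=> t t01; have [r r0 ->] := nF (F (0, t)) (F0 _).
  by exists r => //; rewrite /cst cos0 sin0 mulr1 mulr0.
(* Both [L t] and [b t - a t] are angles of [F (1, t) * conjc (F (0, t))]; their difference is
   therefore constant, and [L] vanishes at both ends. *)
have := @continuous_cos_eq1 _ (fun t => L t - (b t - a t)).
rewrite L0 L1 !sub0r => H.
suff E : - (b 0 - a 0) = - (b 1 - a 1) by lra.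
apply: H => [t|t t01].
  by apply: cvgB; [exact: cL|apply: cvgB; [exact: cb|exact: ca]].
apply: polar_cosB (LP t t01) _.
by apply: polarM; [exact: Fb|apply: polar_conj; exact: Fa].
Qed.

End Winding.

(** * Symmetry of second derivatives *)

Lemma near_eq_differentiable (R : numFieldType) (V W : normedModType R)
  (f g : V -> W) (x : V) :
  {near x, f =1 g} -> differentiable f x -> differentiable g x.
Proof.
move=> fg df; have fgx := nbhs_singleton fg.
suff : differentiable (g - f) x.
  by move=> dgf; rewrite -(subrK f g); exact: differentiableD.
(* The difference vanishes near [x], so it has a first-order expansion with zero linear part. *)
have E : (g - f) \o shift x = cst ((g - f) x) + (\0 : {linear V -> W}) +o_ 0 id.
  apply/eqaddoP => _/posnumP[e] /=.
  near=> h; rewrite !fctE /= fgx subrr.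
  rewrite (_ : f (h + x) = g (h + x)); first by rewrite !subrr addr0 subrr normr0.
  near: h; have := fg.
  by rewrite (near_shift 0 x) subr0; apply: filterS => h /= ->.
apply/diff_locallyP; rewrite (diff_unique _ E); last exact: cst_continuous.
by split=> //; exact: cst_continuous.
Unshelve. all: by end_near. Qed.

Lemma is_derive_line (R : numFieldType) (V W : normedModType R) (f : V -> W)
  (q v : V) (x : R) : derivable f (x *: v + q) v ->
  is_derive x 1 (fun y => f (y *: v + q)) ('D_v f (x *: v + q)).
Proof.
rewrite /derivable /derive => df.
suff E : (fun h : R => h^-1 *: (((fun y => f (y *: v + q)) \o shift x) (h *: 1) -
     f (x *: v + q))) = (fun h => h^-1 *: ((f \o shift (x *: v + q)) (h *: v) -
     f (x *: v + q))).
  by split; rewrite /derivable /derive E.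
apply/funext => h /=; congr (_ *: (f _ - _)).
by rewrite [h *: 1]mulr1 scalerDl addrA.
Qed.

Section Schwarz.
Context {R : realType} {V : normedModType R}.
Implicit Types (f : V -> R) (p v w : V).

Definition second_difference f p v w (h : R) : R :=
  f (h *: v + (h *: w + p)) - f (h *: v + p) - f (h *: w + p) + f p.

Lemma second_differenceC f p v w h :
  second_difference f p v w h = second_difference f p w v h.
Proof. by rewrite /second_difference [h *: v + (_ + _)]addrCA [_ - _ - _]addrAC. Qed.

(* Apply the mean value theorem in the direction v to the increment of f in the
   direction w, then use the differentiability of 'D_v f at p. *)
Lemma second_difference_approx f p v w :
  (\forall q \near p, derivable f q v) -> differentiable ('D_v f) p ->
  forall e, 0 < e -> \forall h \near 0^'+,
    `|second_difference f p v w h - h ^+ 2 * 'D_w ('D_v f) p| <= e * h ^+ 2.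
Proof.
move=> df dg e e0; set g := 'D_v f in dg *.
(* The expansion of g is used at two points, at distances at most h (|v| + |w|) and h |v| from p;
   the sum gives 2 |v| + |w|, and the 1 keeps C positive. *)
pose C := 2 * `|v| + `|w| + 1.
have C0 : 0 < C by rewrite /C ltr_wpDl// addr_ge0// mulr_ge0.
have gP : \forall y \near p,
    `|g y - g p - 'd g p (y - p)| <= e / C * `|y - p|.
  have /eqaddoP /(_ (e / C)) := diff_locally dg.
  move=> /(_ (divr_gt0 e0 C0)) gP.
  have := (near_shift 0 p (fun y => `|g y - g p - 'd g p (y - p)| <= e / C * `|y - p|)).
  rewrite /= => ->; rewrite subr0; apply: filterS gP => h.
  by rewrite !fctE /= addrK opprD addrA.
have : \forall y \near p, derivable f y v /\
    `|g y - g p - 'd g p (y - p)| <= e / C * `|y - p|.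
  by near=> y; split; near: y.
move=> /nbhs_ballP [d /= d0 dP].
near=> h.
have h0 : 0 < h by near: h; exact: nbhs_right_gt.
have hd : h * C < d.
  by rewrite -ltr_pdivlMr//; near: h; apply: nbhs_right_lt; exact: divr_gt0.
have bP x (b : bool) : 0 <= x <= h -> let y := x *: v + (if b then h *: w + p else p) in
    derivable f y v /\ `|g y - g p - 'd g p (y - p)| <= e / C * `|y - p|.
  move=> /andP[x0 xh] y; apply: dP; rewrite -ball_normE /= distrC.
  apply: le_lt_trans hd; rewrite /y.
  have xv : `|x *: v| <= h * `|v| by rewrite normrZ ger0_norm// ler_wpM2r.
  have hw : `|h *: w| = h * `|w| by rewrite normrZ gtr0_norm.
  have hv0 : 0 <= h * `|v| by rewrite mulr_ge0// ltW.
  have hw0 : 0 <= h * `|w| by rewrite mulr_ge0// ltW.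
  case: b {y}.
    rewrite addrA addrK; apply: le_trans (ler_normD _ _) _.
    by rewrite /C; nra.
  by rewrite addrK /C; nra.
pose u x := f (x *: v + (h *: w + p)) - f (x *: v + p).
pose du x := g (x *: v + (h *: w + p)) - g (x *: v + p).
have udu x : 0 <= x <= h -> is_derive x 1 u (du x).
  move=> xh; apply: is_deriveB; apply: is_derive_line.
    exact: (bP x true xh).1.
  exact: (bP x false xh).1.
have [||c ch E] := @MVT R u du 0 h h0.
- by move=> x; rewrite in_itv /= => /andP[/ltW x0 /ltW xh]; apply: udu; apply/andP.
- apply: derivable_within_continuous => x; rewrite in_itv /= => xh.
  by have [] := udu x xh.
have {}E : second_difference f p v w h = du c * h.
  move: E; rewrite subr0 => <-; rewrite /second_difference /u !scale0r !add0r; ring.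
have {}ch : 0 <= c <= h by move: ch; rewrite in_itv /= => /andP[/ltW -> /ltW ->].
rewrite E expr2 -mulrA [h * (h * _)]mulrC -mulrBl normrM (gtr0_norm h0) mulrA.
rewrite ler_wpM2r ?(ltW h0)//.
have [_] := bP c true ch; have [_] := bP c false ch.
have -> : c *: v + (h *: w + p) - p = c *: v + h *: w by rewrite addrA addrK.
rewrite addrK linearD linearZ [in 'd g p (h *: w)]linearZ /=.
rewrite /du deriveE//.
have nv : `|c *: v| <= h * `|v|.
  by move/andP: ch => [c0 hc]; rewrite normrZ ger0_norm// ler_wpM2r.
have nvw : `|c *: v + h *: w| <= h * `|v| + h * `|w|.
  by apply: le_trans (ler_normD _ _) _; rewrite lerD// normrZ gtr0_norm.
have eC0 : 0 < e / C by exact: divr_gt0.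
move=> H1 H2.
have {}H1 := le_trans H1 (ler_wpM2l (ltW eC0) nv).
have {}H2 := le_trans H2 (ler_wpM2l (ltW eC0) nvw).
have K : e / C * (h * `|v| + h * `|w|) + e / C * (h * `|v|) <= e * h.
  rewrite -mulrDr -mulrA ler_wpM2l ?(ltW e0)// ler_pdivrMl//.
  rewrite /C; have := normr_ge0 v; have := normr_ge0 w; nra.
(* Subtracting the two expansions cancels the contribution of [c *: v], whose position c is unknown,
   and leaves h times the derivative along w. *)
have key (X Y Z A b B1 B2 : R) : `|X - Z - A| <= B1 ->
    `|Y - Z - (A + h * b)| <= B2 -> B2 + B1 <= e * h -> `|Y - X - h * b| <= e * h.
  by rewrite !ler_norml; lra.
exact: key H1 H2 K.
Unshelve. all: by end_near. Qed.

(** One second difference, symmetric in v and w, approximates h^2 times either iterated derivative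
    up to e / 2 * h^2; dividing by h^2 gives the claim. Differentiability of the first derivatives
    at p suffices, in the manner of Young's theorem. *)
Lemma derive_derive_sym f p v w :
  (\forall q \near p, derivable f q v) -> (\forall q \near p, derivable f q w) ->
  differentiable ('D_v f) p -> differentiable ('D_w f) p ->
  'D_w ('D_v f) p = 'D_v ('D_w f) p.
Proof.
move=> dfv dfw dv dw; apply/eqP; rewrite -subr_eq0 -normr_le0.
apply/ler_addgt0Pl => e e0; rewrite addr0.
have e20 : 0 < e / 2 by rewrite divr_gt0.
have [h [[h0 A] B]] : exists h, (0 < h /\
    `|second_difference f p v w h - h ^+ 2 * 'D_w ('D_v f) p| <= e / 2 * h ^+ 2) /\
    `|second_difference f p w v h - h ^+ 2 * 'D_v ('D_w f) p| <= e / 2 * h ^+ 2.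
  apply: (@filter_ex _ (0^'+ : set_system R)).
  apply: filterI; last exact: second_difference_approx.
  by apply: filterI; [exact: nbhs_right_gt|exact: second_difference_approx].
rewrite -(ler_pM2r (exprn_gt0 2 h0)).
rewrite -[in leLHS](gtr0_norm (exprn_gt0 2 h0)) -normrM.
have key (S X Y h2 : R) : `|S - h2 * X| <= e / 2 * h2 ->
    `|S - h2 * Y| <= e / 2 * h2 -> `|(X - Y) * h2| <= e * h2.
  move=> SX SY; have -> : (X - Y) * h2 = (S - h2 * Y) - (S - h2 * X) by ring.
  apply: le_trans (ler_normB _ _) _; apply: le_trans (lerD SY SX) _.
  by rewrite -mulrDl -splitr.
by move: A; rewrite second_differenceC => A; exact: key A B.
Qed.

End Schwarz.

(** * Derivatives of maps preserving alpha *)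

Lemma is_derive_coord (R : realType) (V : normedModType R) (m n : nat)
  (f : V -> 'M[R]_(m, n)) (p v : V) i j : derivable f p v ->
  is_derive p v (fun x => f x i j) ('D_v f p i j).
Proof.
move=> df; apply: DeriveDef; first exact: (derivable_mxP f p v).1.
by rewrite derive_mx// mxE.
Qed.

Lemma derive_derive_sym_mx (R : realType) (V : normedModType R) (m n : nat)
  (f : V -> 'M[R]_(m, n)) (p v w : V) :
  (\forall q \near p, differentiable f q) ->
  differentiable ('D_v f) p -> differentiable ('D_w f) p ->
  'D_w ('D_v f) p = 'D_v ('D_w f) p.
Proof.
move=> df dv dw; apply/matrixP => i j.
pose c (g : V -> 'M[R]_(m, n)) (x : V) := g x i j.
have dc (g : V -> 'M[R]_(m, n)) q : differentiable g q -> differentiable (c g) q.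
  move=> dg.
  apply: (@differentiable_comp _ _ _ _ g (fun M : 'M[R]_(m, n) => M i j)) => //.
  exact: differentiable_coord.
have near_c u : \forall q \near p, c ('D_u f) q = 'D_u (c f) q.
  apply: filterS df => q dq; rewrite /c.
  by rewrite [RHS](derive_val (is_derive := is_derive_coord i j (diff_derivable dq))).
have dcu u : differentiable ('D_u f) p -> differentiable ('D_u (c f)) p.
  by move=> du; apply: near_eq_differentiable (near_c u) _; exact: dc.
have dd u u' : differentiable ('D_u f) p ->
    'D_u' ('D_u f) p i j = 'D_u' ('D_u (c f)) p.
  move=> du; rewrite -(near_eq_derive _ (near_c u)).
  by rewrite (derive_val (is_derive := is_derive_coord i j (diff_derivable du))).
have dcq u : \forall q \near p, derivable (c f) q u.
  by apply: filterS df => q dq; apply: diff_derivable; exact: dc.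
transitivity ('D_w ('D_v (c f)) p); first exact: dd.
transitivity ('D_v ('D_w (c f)) p); last exact/esym/dd.
exact: (derive_derive_sym (dcq v) (dcq w) (dcu v dv) (dcu w dw)).
Qed.

Section Symplectic.
Context {R : realType} {k : nat}.
Local Notation V := 'rV[R]_(k + k).
Implicit Types (p v w : V).

(** Plays two roles: Gram matrix of the symplectic form, and, for row vectors (x, y) read as x + i
    y, multiplication by i on the right, sending (x, y) to (-y, x). *)
Definition symplectic_mx : 'M[R]_(k + k) := block_mx 0 1%:M (- 1%:M) 0.
Local Notation Omega := symplectic_mx.

Lemma alphaE p v : alpha p v = 2^-1 * (p *m Omega *m v^T) 0 0.
Proof.
rewrite /alpha; congr (_ * _).
rewrite -(hsubmxK p) -(hsubmxK v) /Omega mul_row_block tr_row_mx mul_row_col.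
rewrite !mulmx0 !mulmx1 add0r addr0 mulmxN mulmx1.
rewrite !mxE -big_split /=; apply: eq_bigr => i _.
by rewrite !row_mxEl !row_mxEr !mxE addrC mulNr.
Qed.

Lemma is_derive_alpha (f g : V -> V) p v : derivable f p v -> derivable g p v ->
  is_derive p v (fun q => alpha (f q) (g q))
    (alpha ('D_v f p) (g p) + alpha (f p) ('D_v g p)).
Proof.
move=> df dg.
have fi i := is_derive_coord 0 i df; have gi i := is_derive_coord 0 i dg.
pose h (i : 'I_k) : V -> R :=
  (fun q => f q 0 (lshift k i)) * (fun q => g q 0 (rshift k i)) -
  (fun q => f q 0 (rshift k i)) * (fun q => g q 0 (lshift k i)).
rewrite (_ : (fun q => _) = 2^-1 *: \sum_(i < k) h i); last first.
  apply/funext => q; rewrite /alpha fctE fct_sumE.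
  by congr (_ * _).
apply: is_derive_eq.
rewrite /alpha -mulrDr -big_split /=; congr (_ * _).
by apply: eq_bigr => i _; rewrite /GRing.scale /=; ring.
Qed.


Lemma alphaC p v : alpha p v = - alpha v p.
Proof.
rewrite /alpha -mulrN -sumrN; congr (_ * _).
by apply: eq_bigr => i _; ring.
Qed.

Lemma alphar0 p : alpha p 0 = 0.
Proof. by rewrite alphaE trmx0 mulmx0 mxE mulr0. Qed.

(** On an open set the local extension agrees with f near the point, so its derivatives are those of
    f. Two orders are extracted, as the symmetry of second derivatives requires. *)
Lemma smooth_on_differentiable (A : set V) (f : V -> V) p : open A ->
  smooth_on A f -> A p -> (\forall q \near p, differentiable f q) /\
  (forall i, differentiable ('D_(delta_mx 0 i) f) p).
Proof.
move=> oA sf Ap; have [U [g [oU Up sg fg]]] := sf p Ap.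
have O q : U q -> A q -> \forall x \near q, U x /\ A x.
  move=> Uq Aq; have : nbhs q (U `&` A).
    by apply: open_nbhs_nbhs; split; [exact: openI|].
  by apply: filterS => x.
have fgE q : U q -> A q -> {near q, g =1 f}.
  move=> Uq Aq; apply: filterS (O q Uq Aq) => x [Ux Ax].
  by rewrite fg// inE.
split=> [|i].
  apply: filterS (O p Up Ap) => q [Uq Aq].
  by apply: near_eq_differentiable (fgE q Uq Aq) _; exact: (sg [::]).
apply: (@near_eq_differentiable _ _ _ ('D_(delta_mx 0 i) g)); last exact: (sg [:: i]).
apply: filterS (O p Up Ap) => q [Uq Aq].
by apply: near_eq_derive; exact: fgE.
Qed.

Lemma open_punctured : open (@punctured R k).
Proof.
have -> : @punctured R k = ~` [set 0] by apply/seteqP; split=> x /= => [/eqP|/eqP].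
by apply: closed_openC; exact: accessible_closed_set1 (hausdorff_accessible _) _.
Qed.

Lemma jacobianE (f : V -> V) p i : differentiable f p ->
  row i ('J f p) = 'D_(delta_mx 0 i) f p.
Proof. by move=> df; rewrite rowE /jacobian mul_rV_lin1 deriveE. Qed.

(** This is invariance of d alpha, obtained by differentiating alpha (phi, D_j phi) = alpha (q, e_j)
    along e_i, with e_i and e_j constant fields. *)
Lemma jacobian_symplectic (phi : V -> V) p : Diff1_alpha_str phi -> p != 0 ->
  'J phi p *m Omega *m ('J phi p)^T = Omega.
Proof.
move=> [[[_ _ sphi _] _] aphi] p0.
have [dphi ddphi] := smooth_on_differentiable open_punctured sphi p0.
pose e (i : 'I_(k + k)) : V := delta_mx 0 i.
have rowJ i : row i ('J phi p) = 'D_(e i) phi p.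
  exact: jacobianE (nbhs_singleton dphi).
have key i j : alpha ('D_(e i) phi p) ('D_(e j) phi p) +
    alpha (phi p) ('D_(e i) ('D_(e j) phi) p) = alpha (e i) (e j).
  have D1 : is_derive p (e i) (fun q => alpha (phi q) ('D_(e j) phi q))
      (alpha ('D_(e i) phi p) ('D_(e j) phi p) +
       alpha (phi p) ('D_(e i) ('D_(e j) phi) p)).
    by apply: is_derive_alpha; apply: diff_derivable => //; exact: (nbhs_singleton dphi).
  have D2 : is_derive p (e i) (fun q : V => alpha q (e j)) (alpha (e i) (e j)).
    have := @is_derive_alpha id (cst (e j)) p (e i)
      (@derivable_id _ _ _ _) (@derivable_cst _ _ _ _ _ _).
    by rewrite derive_id derive_cst alphar0 addr0.
  rewrite -(derive_val (is_derive := D1)) -(derive_val (is_derive := D2)).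
  apply: near_eq_derive.
  have nP : \forall q \near p, q != 0.
    by apply: open_nbhs_nbhs; split; [exact: open_punctured|exact: p0].
  near=> q; rewrite deriveE; last by near: q.
  by apply: aphi; rewrite inE; near: q.
(* The term with the second derivative is the same for (i, j) and (j, i), while [alpha] changes
   sign; subtracting the two instances of [key] removes it. *)
have sym i j : alpha ('D_(e i) phi p) ('D_(e j) phi p) = alpha (e i) (e j).
  have ds : 'D_(e j) ('D_(e i) phi) p = 'D_(e i) ('D_(e j) phi) p.
    exact: derive_derive_sym_mx dphi (ddphi i) (ddphi j).
  have asym (a b c d : V) z : alpha a b + z = alpha c d -> alpha b a + z = alpha d c ->
      alpha a b = alpha c d :> R.
    by rewrite (alphaC b) (alphaC d); lra.
  by apply: asym (key i j) _; rewrite -ds; exact: key.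
apply/matrixP => i j.
have E (M : 'M[R]_(k + k)) : M i j = (e i *m M *m (e j)^T) 0 0.
  by rewrite -rowE trmx_delta -colE !mxE.
have := sym i j; rewrite !alphaE -!rowJ !rowE trmx_mul !mulmxA.
move=> /mulfI H; rewrite [LHS]E [RHS]E !mulmxA; apply: H.
by rewrite invr_eq0 pnatr_eq0.
Unshelve. all: by end_near. Qed.

Lemma dotmx_ge0 n (x : 'rV[R]_n) : 0 <= (x *m x^T) 0 0.
Proof. by rewrite mxE sumr_ge0 => // i _; rewrite mxE -expr2 sqr_ge0. Qed.

Lemma dotmx_eq0 n (x : 'rV[R]_n) : (x *m x^T) 0 0 = 0 -> x = 0.
Proof.
rewrite mxE => /eqP; rewrite psumr_eq0 => [/allP x0|i _]; last first.
  by rewrite mxE -expr2 sqr_ge0.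
apply/rowP => i; have := x0 i (mem_index_enum _).
by rewrite mxE -expr2 sqrf_eq0 mxE => /eqP.
Qed.

(* The matrix of the complex-linear part of z |-> z *m B, where the row vector
   (x, y) stands for x + i y. *)
Definition complex_linear_part (B : 'M[R]_(k + k)) : 'M[R[i]]_k :=
  \matrix_(i, j) Complex
    (2^-1 * (B (lshift k i) (lshift k j) + B (rshift k i) (rshift k j)))
    (2^-1 * (B (lshift k i) (rshift k j) - B (rshift k i) (lshift k j))).

(* If v represents z in the kernel, B anticommutes with the complex structure J
   on v, so |v|^2 = omega (v, J v) = omega (v B, (J v) B) = - |v B|^2. *)
Lemma det_complex_linear_part (B : 'M[R]_(k + k)) :
  B *m Omega *m B^T = Omega -> \det (complex_linear_part B) != 0.
Proof.
move=> symB; apply/negP => /det0P [z z0 zM].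
pose x := map_mx (@complex.Re R) z; pose y := map_mx (@complex.Im R) z.
have Re_sum (I : Type) (r : seq I) (F : I -> R[i]) :
    complex.Re (\sum_(i <- r) F i) = \sum_(i <- r) complex.Re (F i).
  by apply: (big_morph (@complex.Re R)) => // -[? ?] [].
have Im_sum (I : Type) (r : seq I) (F : I -> R[i]) :
    complex.Im (\sum_(i <- r) F i) = \sum_(i <- r) complex.Im (F i).
  by apply: (big_morph (@complex.Im R)) => // -[? ?] [].
pose P := ulsubmx B; pose Q := ursubmx B; pose S := dlsubmx B; pose T := drsubmx B.
have half0 : (2^-1 : R) != 0 by rewrite invr_eq0 pnatr_eq0.
(* [e1] and [e2] are the real and imaginary parts of [zM], doubled. For v = (x, y) and J v = (-y, x)
   they say together that (J v) B = - J (v B). *)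
have e1 : x *m P + y *m S = y *m Q - x *m T.
  apply/eqP; rewrite -subr_eq0; apply/eqP/rowP => j.
  have /(congr1 (fun M : 'rV_k => complex.Re (M 0 j))) := zM.
  rewrite !mxE Re_sum /= -!sumrN -!big_split -sumrN -big_split /= => H.
  apply: (mulfI half0); rewrite mulr0 -[RHS]H mulr_sumr.
  apply: eq_bigr => i _; rewrite !mxE; case: (z 0 i) => a b /=.
  ring.
have e2 : x *m Q + y *m T = x *m S - y *m P.
  apply/eqP; rewrite -subr_eq0; apply/eqP/rowP => j.
  have /(congr1 (fun M : 'rV_k => complex.Im (M 0 j))) := zM.
  rewrite !mxE Im_sum /= -!sumrN -!big_split -sumrN -big_split /= => H.
  apply: (mulfI half0); rewrite mulr0 -[RHS]H mulr_sumr.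
  apply: eq_bigr => i _; rewrite !mxE; case: (z 0 i) => a b /=.
  ring.
have EB : B = block_mx P Q S T by rewrite submxK.
have OmE (a b c d : 'rV[R]_k) :
    row_mx a b *m Omega *m (row_mx c d)^T = a *m d^T - b *m c^T.
  rewrite /Omega mul_row_block tr_row_mx mul_row_col.
  by rewrite !mulmx0 !mulmx1 add0r addr0 mulmxN mulmx1 mulNmx addrC.
have : (row_mx x y *m B) *m Omega *m (row_mx (- y) x *m B)^T =
    row_mx x y *m Omega *m (row_mx (- y) x)^T.
  by rewrite trmx_mul !mulmxA -[X in X *m _ = _]mulmxA -[X in X *m _ = _]mulmxA
     (mulmxA B) symB.
have BE (a b : 'rV[R]_k) : row_mx a b *m B = row_mx (a *m P + b *m S) (a *m Q + b *m T).
  by rewrite EB mul_row_block.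
rewrite !BE.
have -> : - y *m P + x *m S = x *m Q + y *m T by rewrite e2 mulNmx addrC.
have -> : - y *m Q + x *m T = - (x *m P + y *m S) by rewrite e1 mulNmx opprB addrC.
rewrite !OmE; move: (x *m P + _) (x *m Q + _) => u w.
have trN (a : 'rV[R]_k) : (- a)^T = - a^T by apply/matrixP => ? ?; rewrite !mxE.
rewrite !trN !mulmxN opprK => /(congr1 (fun M : 'M[R]_1 => M 0 0)).
have sq (a b c d : 'M[R]_1) : (- a - b) 0 0 = (c + d) 0 0 ->
    a 0 0 + b 0 0 + c 0 0 + d 0 0 = 0 by rewrite !mxE; lra.
move=> /sq uwxy; have := dotmx_ge0 u; have := dotmx_ge0 w.
have := dotmx_ge0 x; have := dotmx_ge0 y => y0' x0' w0' u0'.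
have x0 : x = 0 by apply: dotmx_eq0; lra.
have y0 : y = 0 by apply: dotmx_eq0; lra.
move/negP: z0; apply; apply/eqP/rowP => i.
have := congr1 (fun M : 'rV_k => M 0 i) x0.
have := congr1 (fun M : 'rV_k => M 0 i) y0; rewrite /x /y !mxE.
by case: (z 0 i) => a b /= -> ->.
Qed.

End Symplectic.

(** * Rotations *)

Lemma continuous_mulmxr (R : realType) (m n : nat) (M : 'M[R]_(m, n)) :
  continuous (fun q : 'rV[R]_m => q *m M).
Proof.
rewrite (_ : (fun q => _) = fun q : 'rV[R]_m => \sum_i q 0 i *: row i M).
  apply: continuous_big => [|i _ q]; first exact: add_continuous.
  exact: cvgZr_tmp (@coord_continuous R 1 m 0 i q).
by apply/funext => q; rewrite mulmx_sum_row.
Qed.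

Lemma is_diff_mulmxr (R : realType) (m n : nat) (M : 'M[R]_(m, n)) (p : 'rV[R]_m) :
  is_diff p (fun q : 'rV[R]_m => q *m M) (fun q : 'rV[R]_m => q *m M).
Proof.
have cM := @continuous_mulmxr R m n M.
apply: DiffDef; first exact: (@linear_differentiable _ _ _ (mulmxr M)).
exact: (@diff_lin _ _ _ (mulmxr M)).
Qed.

Lemma partials_mulmxr (R : realType) (m n : nat) (M : 'M[R]_(m, n)) (s : seq 'I_m) :
  partials s (fun q : 'rV[R]_m => q *m M) =
  match s with
  | [::] => fun q => q *m M
  | [:: i] => cst (delta_mx 0 i *m M)
  | _ => cst 0
  end.
Proof.
elim: s => [//|i s IH].
rewrite -[LHS]/('D_(delta_mx 0 i) (partials s (fun q : 'rV[R]_m => q *m M))) IH.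
case: s {IH} => [|j [|l s]]; apply/funext => x; rewrite ?derive_cst//.
rewrite deriveE; first by rewrite (@diff_val _ _ _ _ _ _ _ (is_diff_mulmxr M x)).
exact: (@ex_diff _ _ _ _ _ _ _ (is_diff_mulmxr M x)).
Qed.

Lemma smooth_on_mulmxr (R : realType) (m n : nat) (M : 'M[R]_(m, n)) A :
  smooth_on A (fun q : 'rV[R]_m => q *m M).
Proof.
move=> x Ax; exists setT, (fun q => q *m M); split => //; first exact: openT.
move=> s y _; rewrite partials_mulmxr; case: s => [|i [|j s]] //.
exact: (@ex_diff _ _ _ _ _ _ _ (is_diff_mulmxr M y)).
Qed.

(** Stated for [f] that is linear only on [A], because [diffeo] demands the identity outside [A]; it
    serves both the punctured space and the sphere. *)
Lemma diffeo_mulmxr (R : realType) (n : nat) (A : set 'rV[R]_n) (M N : 'M[R]_n) f :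
  (forall p, A p -> A (p *m M)) -> (forall p, A p -> A (p *m N)) ->
  M *m N = 1%:M -> N *m M = 1%:M ->
  (forall p, A p -> f p = p *m M) -> (forall p, ~ A p -> f p = p) -> diffeo A f.
Proof.
move=> AM AN MN NM fM fid; split.
- split.
  + by move=> p Ap; rewrite /= fM//; exact: AM.
  + move=> p q /set_mem Ap /set_mem Aq; rewrite !fM// => /(congr1 (mulmxr N)) /=.
    by rewrite -!mulmxA MN !mulmx1.
  + move=> p Ap; exists (p *m N); first exact: AN.
    by rewrite fM; [rewrite -mulmxA NM mulmx1|exact: AN].
- by move=> p /set_mem /fid.
- move=> p Ap; have [U [g [oU Up sg gE]]] := smooth_on_mulmxr M Ap.
  exists U, g; split => // q /[dup] qAU /set_mem[Aq _].
  by rewrite fM// gE.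
- exists (fun q => q *m N); first exact: smooth_on_mulmxr.
  by move=> p /set_mem Ap; rewrite fM// -mulmxA MN mulmx1.
Qed.

Section Rotation.
Context {R : realType} {k : nat}.
Local Notation V := 'rV[R]_(k + k).
Local Notation Omega := (@symplectic_mx R k).
Implicit Types (p v : V) (a b : R).

Lemma symplectic_mx_sqr : Omega *m Omega = - 1%:M.
Proof.
rewrite /symplectic_mx mulmx_block !mulmx0 !mul0mx !mul1mx !mulmx1 !addr0 !add0r.
by rewrite scalar_mx_block opp_block_mx !oppr0.
Qed.

Lemma tr_symplectic_mx : Omega^T = - Omega.
Proof.
rewrite /symplectic_mx tr_block_mx opp_block_mx !trmx0 trmx1 !oppr0 opprK.
congr block_mx.
by apply/matrixP => i j; rewrite !mxE eq_sym.
Qed.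

(** The matrix of multiplication by e^{i a}, with [Omega], whose square is -1, in the place of i. *)
Definition rotation_mx a : 'M[R]_(k + k) := (cos a)%:M + sin a *: Omega.

Lemma rotation_mxM a b : rotation_mx a *m rotation_mx b = rotation_mx (a + b).
Proof.
rewrite /rotation_mx cosD sinD mulmxDl !mulmxDr !mul_scalar_mx mul_mx_scalar.
rewrite -scalemxAl -scalemxAr symplectic_mx_sqr.
move: Omega => W; apply/matrixP => i j; rewrite !mxE.
by case: (i == j); rewrite ?mulr1n ?mulr0n; ring.
Qed.

Lemma rotation_mx0 : rotation_mx 0 = 1%:M.
Proof. by rewrite /rotation_mx cos0 sin0 scale0r addr0. Qed.

Lemma rotation_mxNr a : rotation_mx a *m rotation_mx (- a) = 1%:M.
Proof. by rewrite rotation_mxM subrr rotation_mx0. Qed.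

Lemma rotation_mxNl a : rotation_mx (- a) *m rotation_mx a = 1%:M.
Proof. by rewrite rotation_mxM addNr rotation_mx0. Qed.

Lemma tr_rotation_mx a : (rotation_mx a)^T = rotation_mx (- a).
Proof.
rewrite /rotation_mx cosN sinN linearD /= tr_scalar_mx linearZ /= tr_symplectic_mx.
by rewrite scalerN scaleNr.
Qed.

Lemma rotation_mx_symplectic a :
  rotation_mx a *m Omega *m (rotation_mx a)^T = Omega.
Proof.
have -> : rotation_mx a *m Omega = Omega *m rotation_mx a.
  by rewrite mulmxDl mulmxDr scalar_mxC -scalemxAl -scalemxAr.
by rewrite tr_rotation_mx -mulmxA rotation_mxNr mulmx1.
Qed.

Definition rotation a : V -> V := fun p => p *m rotation_mx a.

Lemma enorm_rotation a p : enorm (rotation a p) = enorm p.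
Proof.
have E q : enorm q = Num.sqrt ((q *m q^T) 0 0).
  by rewrite /enorm mxE; congr Num.sqrt; apply: eq_bigr => i _; rewrite mxE expr2.
rewrite !E /rotation trmx_mul tr_rotation_mx !mulmxA -[X in X *m _^T]mulmxA.
by rewrite rotation_mxNr mulmx1.
Qed.

Lemma rotation_neq0 a p : p != 0 -> rotation a p != 0.
Proof.
apply: contraNneq => /(congr1 (mulmxr (rotation_mx (- a)))) /=.
by rewrite mul0mx -mulmxA rotation_mxNr mulmx1 => ->.
Qed.

Lemma enormZ r p : 0 <= r -> enorm (r *: p) = r * enorm p.
Proof.
move=> r0; rewrite /enorm (eq_bigr (fun i => r ^+ 2 * p 0 i ^+ 2)).
  by rewrite -mulr_sumr sqrtrM ?sqr_ge0// sqrtr_sqr ger0_norm.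
by move=> i _; rewrite mxE exprMn.
Qed.

Lemma rotation_Diff1_alpha_str_A a : Diff1_alpha_str_A R k (rotation a).
Proof.
have d0 : diffeo (@punctured R k) (rotation a).
  apply: (@diffeo_mulmxr _ _ _ (rotation_mx a) (rotation_mx (- a))) => //.
  - by move=> p; exact: rotation_neq0.
  - by move=> p; exact: rotation_neq0.
  - exact: rotation_mxNr.
  - exact: rotation_mxNl.
  - by move=> p /negP; rewrite negbK => /eqP ->; rewrite /rotation mul0mx.
split; last first.
  (* The preimage under the homogeneous extension has to be normalised to the identity off the
     sphere. *)
  exists (fun p => if enorm p == 1 then rotation a p else p).
    apply: (@diffeo_mulmxr _ _ _ (rotation_mx a) (rotation_mx (- a))).
    - by move=> p; rewrite /sphere /= -/(rotation a p) enorm_rotation.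
    - by move=> p; rewrite /sphere /= -/(rotation (- a) p) enorm_rotation.
    - exact: rotation_mxNr.
    - exact: rotation_mxNl.
    - by move=> p; rewrite /sphere /= => ->; rewrite eqxx.
    - by move=> p; rewrite /sphere /=; case: eqP.
  apply/funext => p; rewrite /homogeneous_extension.
  have [/eqP/enorm_eq0 ->|p0] := boolP (enorm p == 0).
    rewrite /rotation !mul0mx scaler0; case: ifP => _; last by rewrite scaler0.
    by rewrite mul0mx scaler0.
  rewrite enormZ ?invr_ge0 ?sqrtr_ge0// mulVf// eqxx /rotation -scalemxAl.
  by rewrite scalerA divff// scale1r.
split; first by split=> // r p _ _; rewrite /rotation -scalemxAl.
move=> p _ v; rewrite /pullback.
rewrite (@diff_val _ _ _ _ _ _ _ (is_diff_mulmxr (rotation_mx a) p)) !alphaE.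
rewrite trmx_mul !mulmxA -[X in X *m _^T]mulmxA.
by rewrite -[X in X *m _^T]mulmxA (mulmxA _ Omega) rotation_mx_symplectic.
Qed.

End Rotation.

(** * The loops of rotations *)

Lemma continuous_into_set_type (S T : topologicalType) (A : set T) (f : S -> A) :
  continuous (fun x => set_val (f x)) -> continuous f.
Proof. exact: (@continuous_comp_initial _ _ _ set_val f). Qed.

Lemma continuous_into_ptws (S T : topologicalType) (I : Type)
  (f : S -> {ptws I -> T}) :
  (forall i, continuous (fun x => f x i)) -> continuous f.
Proof.
move=> cf x; apply/cvg_sup => i.
exact: (@continuous_comp_initial _ _ _ (fun g : I -> T => g i) f (cf i)).
Qed.

(** The currying half of the exponential law: joint continuity at each (x, y) becomes uniform over y
    in a compact set by the covering argument. *)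
Lemma continuous_into_family (S T : topologicalType) (U : uniformType)
  (fam : set_system T) (G : S * T -> U) :
  (forall K, fam K -> compact K) -> continuous G ->
  continuous (fun x => (fun y => G (x, y)) : {family fam, T -> U}).
Proof.
move=> famK cG x; apply/fam_cvgP => K /famK /compact_near_coveringP cK.
move=> P /uniform_nbhs [E [entE EP]].
suff : \forall x' \near x, K `<=` (fun y => E (G (x, y), G (x', y))).
  by apply: filterS => x' H; apply: EP.
apply: (cK S (nbhs x) (fun x' y => E (G (x, y), G (x', y)))) => y Ky.
have entS := entourage_split_ent entE.
have near1 : \forall z \near (x, y), split_ent E (G (x, y), G z).
  exact: (cvg_entourageP _ _).1 (cG (x, y)) _ entS.
have near2 : \forall z \near (x, y), split_ent E (G z, G (x, y)).
  exact: (cvg_entourageP _ _).1 (cG (x, y)) _ (entourage_inv entS).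
have [[A B] /= [nA nB] AB] := filterI near1 near2.
exists (B, A) => //= -[y' x'] /= [By' Ax'].
apply: (entourage_split (G (x, y))) => //.
  exact: (AB (x, y') (conj (nbhs_singleton nA) By')).2.
exact: (AB (x', y') (conj Ax' By')).1.
Qed.

(** A singleton is a compact subset of [U], so convergence of a partial derivative on compact
    subsets includes convergence at the point. *)
Lemma Coo_partial_continuous (R : realType) (n m : nat) (U : set 'rV[R]_n)
  (s : seq 'I_n) (p : 'rV[R]_n) : U p ->
  continuous (fun f : Coo_space (m := m) U => partials s f p).
Proof.
move=> Up.
have c1 : continuous (@all_partials R n m U : Coo_space U -> _).
  exact: initial_continuous.
have c2 : continuous (fun g : {ptws seq 'I_n ->
    {family compact_subsets U, 'rV[R]_n -> 'rV[R]_m}} => g s).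
  exact: proj_continuous.
have c3 : continuous (fun g : {family compact_subsets U, 'rV[R]_n -> 'rV[R]_m} => g p).
  move=> g; have FF : Filter (nbhs g) by exact: nbhs_filter.
  have /fam_cvgP/(_ [set p]) : {family compact_subsets U, nbhs g --> g} by [].
  rewrite (uniform_set1 _ _ FF); apply; split; first exact: compact_set1.
  by move=> _ ->.
move=> f.
apply: (continuous_comp _ (c3 _)).
exact: (continuous_comp (c1 f) (c2 _)).
Qed.

Section RotationLoops.
Context {R : realType} {k : nat}.
Local Notation V := 'rV[R]_(k + k).
Local Notation X := (Diff1_alpha_str_A R k).
Local Notation I := (unit_interval R).

Definition rotation_loop (n : nat) (t : I) : X :=
  exist _ (rotation (pi *+ 2 *+ n * set_val t))
    (mem_set (rotation_Diff1_alpha_str_A _)).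

(** It suffices that every iterated partial be jointly continuous in time and position; for a linear
    map these are the map itself, a row of its matrix, and then 0. *)
Lemma continuous_rotation_loop n : continuous (rotation_loop n).
Proof.
apply: continuous_into_set_type.
apply: (@continuous_comp_initial _ _ _ (@all_partials R _ _ (@punctured R k))).
apply: continuous_into_ptws => s.
have cval : continuous (set_val : I -> R) by exact: initial_continuous.
have ca : continuous (fun t : I => pi *+ 2 *+ n * set_val t : R).
  by move=> t; exact: (continuous_comp (cval t) (@mulrl_continuous R _ _)).
pose G (x : I * V) : V := partials s (rotation (pi *+ 2 *+ n * set_val x.1)) x.2.
apply: (@continuous_into_family _ _ _ _ G); first by move=> K [].
have cmul (f : I * V -> V) : continuous f ->
    continuous (fun x => f x *m rotation_mx (pi *+ 2 *+ n * set_val x.1)).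
  move=> cf; pose a (x : I * V) := pi *+ 2 *+ n * set_val x.1 : R.
  have ca1 : continuous a.
    by move=> x; exact: (continuous_comp (@cvg_fst _ _ _ _ _) (ca x.1)).
  rewrite (_ : (fun x => _) = fun x => cos (a x) *: f x +
      sin (a x) *: (f x *m @symplectic_mx R k)); last first.
    by apply/funext => x; rewrite mulmxDr mul_mx_scalar -scalemxAr.
  move=> x; apply: cvgD; apply: cvgZ.
  - exact: (continuous_comp (ca1 x) (@continuous_cos R _)).
  - exact: cf.
  - exact: (continuous_comp (ca1 x) (@continuous_sin R _)).
  - exact: (continuous_comp (cf x) (@continuous_mulmxr R _ _ _ _)).
rewrite /G; under eq_fun do rewrite /rotation partials_mulmxr.
case: s {G} => [|i [|j s]].
- by apply: (cmul snd) => x; exact: cvg_snd.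
- by apply: (cmul (cst _)) => x; exact: cvg_cst.
- by move=> x; exact: cvg_cst.
Qed.

Lemma rotation_loop0 n : rotation_loop n zero = Diff1_id R k.
Proof.
apply: val_inj => /=; apply/funext => p.
by rewrite /rotation /= set_valE /= mulr0 rotation_mx0 mulmx1.
Qed.

Lemma rotation_loop1 n : rotation_loop n one = Diff1_id R k.
Proof.
apply: val_inj => /=; apply/funext => p.
rewrite /rotation /= set_valE /= mulr1.
suff -> : rotation_mx (pi *+ 2 *+ n) = 1%:M :> 'M[R]_(k + k) by rewrite mulmx1.
elim: n => [|n IH]; first exact: rotation_mx0.
rewrite mulrS -rotation_mxM IH mulmx1.
by rewrite /rotation_mx cos2pi sin2pi scale0r addr0.
Qed.

Definition rotation_path n : {path I from Diff1_id R k to Diff1_id R k} :=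
  mk_path (@continuous_rotation_loop n) (rotation_loop0 n) (rotation_loop1 n).

(** Written with [partials], which the topology controls directly; the matrix is the Jacobian
    wherever [phi] is differentiable. *)
Definition complex_jacobian_det (p : V) (phi : V -> V) : R[i] :=
  \det (complex_linear_part (\matrix_(i, j) partials [:: i] phi p 0 j)).

Lemma complex_jacobian_det_continuous p : p != 0 ->
  ccontinuous (fun phi : X => complex_jacobian_det p (set_val phi)).
Proof.
move=> p0.
have cB i j : continuous (fun phi : X => partials [:: i] (set_val phi) p 0 j).
  move=> phi.
  apply: (@continuous_comp _ _ _ (fun phi : X => partials [:: i] (set_val phi) p)
    (fun v : V => v 0 j)); last exact: coord_continuous.
  apply: (@continuous_comp _ _ _ (set_val : X -> _)
    (fun f : Coo_space (m := k + k) (@punctured R k) => partials [:: i] f p)).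
    exact: initial_continuous.
  exact: Coo_partial_continuous.
apply: ccontinuous_det => i j; split => phi.
  rewrite (_ : (fun x => _) = fun x : X => 2^-1 *
      (partials [:: lshift k i] (set_val x) p 0 (lshift k j) +
       partials [:: rshift k i] (set_val x) p 0 (rshift k j))); last first.
    by apply/funext => x; rewrite !mxE.
  exact: continuous_comp (cvgD (cB _ _ phi) (cB _ _ phi)) (@mulrl_continuous R _ _).
rewrite (_ : (fun x => _) = fun x : X => 2^-1 *
    (partials [:: lshift k i] (set_val x) p 0 (rshift k j) -
     partials [:: rshift k i] (set_val x) p 0 (lshift k j))); last first.
  by apply/funext => x; rewrite !mxE.
exact: continuous_comp (cvgB (cB _ _ phi) (cB _ _ phi)) (@mulrl_continuous R _ _).
Qed.

Lemma complex_jacobian_det_neq0 p (phi : X) : p != 0 ->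
  complex_jacobian_det p (set_val phi) != 0.
Proof.
move=> p0; have [aphi _] : X (set_val phi) by apply: set_mem; exact: valP.
rewrite /complex_jacobian_det.
suff -> : (\matrix_(i, j) partials [:: i] (set_val phi) p 0 j) = 'J (set_val phi) p.
  by apply: det_complex_linear_part; exact: jacobian_symplectic.
have [_ _ sphi _] := aphi.1.1.
have [dphi _] := smooth_on_differentiable open_punctured sphi p0.
apply/row_matrixP => i; rewrite (jacobianE _ (nbhs_singleton dphi)).
by apply/rowP => j; rewrite !mxE.
Qed.

(** A rotation is already complex-linear, so its complex-linear part is the scalar matrix e^{i a} of
    size k. *)
Lemma complex_jacobian_det_rotation p a :
  polar (complex_jacobian_det p (rotation a)) (a *+ k).
Proof.
rewrite /complex_jacobian_det.
have -> : \matrix_(i, j) partials [:: i] (rotation a) p 0 j =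
    rotation_mx a :> 'M[R]_(k + k).
  by apply/matrixP => i j; rewrite mxE partials_mulmxr -rowE mxE.
have E : rotation_mx a =
    block_mx (cos a)%:M (sin a)%:M (- sin a)%:M (cos a)%:M :> 'M[R]_(k + k).
  rewrite /rotation_mx scalar_mx_block scale_block_mx add_block_mx !scaler0.
  by rewrite !addr0 !add0r scalerN -scaleNr !scalemx1.
have -> : complex_linear_part (rotation_mx a) =
    (Complex (cos a) (sin a))%:M :> 'M[R[i]]_k.
  apply/matrixP => i j; rewrite mxE E !block_mxEul !block_mxEur !block_mxEdl !block_mxEdr.
  rewrite !mxE; case: (i == j); rewrite ?mulr1n ?mulr0n.
    by congr Complex; lra.
  by rewrite addr0 subrr mulr0.
rewrite det_scalar; apply: polarX; exists 1 => //.
by rewrite !mul1r.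
Qed.

Definition to_unit_interval (t : R) : I := exist _ (clamp t) (mem_set (clamp_itv t)).

Lemma to_unit_interval_continuous : continuous to_unit_interval.
Proof. by apply: continuous_into_set_type; exact: continuous_clamp. Qed.

Lemma to_unit_interval0 : to_unit_interval 0 = zero.
Proof. by apply: val_inj => /=; rewrite clamp_id// in_itv /= lexx ler01. Qed.

Lemma to_unit_interval1 : to_unit_interval 1 = one.
Proof. by apply: val_inj => /=; rewrite clamp_id// in_itv /= lexx ler01. Qed.

Lemma rotation_path_homotopic m n : (0 < k)%N ->
  path_homotopic (rotation_path m) (rotation_path n) -> m = n.
Proof.
move=> k0 [H [cH H0 H1 Hs]].
(* Any base point off the origin would do; the all-ones vector is one as soon as 0 < k. *)
pose p : V := const_mx 1.
have p0 : p != 0.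
  apply/eqP => /(congr1 (fun q : V => q 0 (lshift k (Ordinal k0)))).
  by rewrite !mxE => /eqP; rewrite oner_eq0.
pose F (x : R * R) := complex_jacobian_det p
  (set_val (H (to_unit_interval x.1, to_unit_interval x.2))).
have cF : ccontinuous F.
  have cH2 : continuous (fun x : R * R => H (to_unit_interval x.1, to_unit_interval x.2)).
    have cpair : continuous (fun x : R * R =>
        (to_unit_interval x.1, to_unit_interval x.2)).
      apply: continuous_pair => x; apply: continuous_comp.
      - exact: cvg_fst.
      - exact: to_unit_interval_continuous.
      - exact: cvg_snd.
      - exact: to_unit_interval_continuous.
    move=> x; apply: continuous_comp; [exact: cpair|exact: cH].
  exact: ccontinuous_comp cH2 (complex_jacobian_det_continuous p0).
have F0 x : F x != 0 by exact: complex_jacobian_det_neq0.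
have Fs s : F (s, 0) = F (0, 0) /\ F (s, 1) = F (0, 1).
  by rewrite /F /= to_unit_interval0 to_unit_interval1 !(Hs _).1 !(Hs _).2.
have Fn q s : (forall t, H (to_unit_interval s, t) = rotation_path q t) ->
  forall t : R, t \in `[0, 1] -> polar (F (s, t)) ((pi *+ 2 *+ q * t) *+ k).
  move=> Hq t t01; rewrite /F /= Hq /=.
  have -> : pi *+ 2 *+ q * t = pi *+ 2 *+ q * clamp t by rewrite clamp_id.
  exact: complex_jacobian_det_rotation.
have cl q : continuous (fun t : R => (pi *+ 2 *+ q * t) *+ k).
  rewrite (_ : (fun t => _) = *%R ((pi *+ 2 *+ q) *+ k)); last first.
    by apply/funext => t; rewrite [RHS]mulrnAl.
  exact: mulrl_continuous.
have := winding_homotopy_invariant cF F0 Fs (cl m) (cl n).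
rewrite !mulr1 !mulr0 !mul0rn !subr0 => E.
have : pi *+ 2 *+ m *+ k = pi *+ 2 *+ n *+ k :> R.
  by apply: E; apply: Fn => t; rewrite ?to_unit_interval0 ?to_unit_interval1.
rewrite -[LHS]mulrnA -[RHS]mulrnA => Epi.
have pi2 : pi *+ 2 != 0 :> R by rewrite mulrn_eq0 /= gt_eqF ?pi_gt0.
by have /eqP := mulrIn pi2 Epi; rewrite eqn_pmul2r// => /eqP.
Qed.

End RotationLoops.

Theorem corollary4p3 (R : realType) (k : nat) (hk : (1 <= k)%N) :
  infinite_set (pi1 R (Diff1_id R k)).
Proof.
pose c n := path_homotopic (@rotation_path R k n).
apply: (@sub_infinite_set _ (range c)).
  by move=> _ [n _ <-]; exists (rotation_path n).
(* Classes are predicates on paths: equality of [c m] and [c n], evaluated at [rotation_path n],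
   turns the constant homotopy into a homotopy from [rotation_path m] to [rotation_path n]. *)
have c_inj : injective c.
  move=> m n cmn; apply: (@rotation_path_homotopic R k) => //.
  rewrite -/(c m) cmn; exists (fun x => rotation_path n x.2); split => //.
    move=> x; apply: continuous_comp; first exact: cvg_snd.
    exact: continuous_rotation_loop.
  by move=> s; rewrite !path_zero !path_one.
move=> fc; apply: infinite_nat.
have := finite_preimage (f := c) (in2W c_inj) fc.
by apply: sub_finite_set => n _; exists n.
Qed.
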